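(* Let $\mu>0$, $\lambda>0$ and let $W$ be a random variable with the inverse Gaussian distribution $IG(\mu,\lambda)$. Then for every $x\in[0,\infty)$, $$\Phi\left(G_{IG(\mu,\lambda)}(x)\right)\leq\Pr\left(W\leq x\right),$$ where $G_{IG(\mu,\lambda)}$ denotes the signed log-likelihood of $IG(\mu,\lambda)$ and $\Phi$ is the distribution function of the standard Gaussian.
   Context: $IG(\mu,\lambda)$ is the distribution on $(0,\infty)$ with density $$f(x)=\left(\frac{\lambda}{2\pi x^{3}}\right)^{1/2}\exp\left(\frac{-\lambda(x-\mu)^{2}}{2\mu^{2}x}\right),$$ which has mean $\mu$ and shape parameter $\lambda$. For fixed $\lambda$ these belong to one exponential family, with $IG(x,\lambda)$ the member with mean $x>0$. The signed log-likelihood is, for $x>0$, $$G_{IG(\mu,\lambda)}(x)=\begin{cases}-\left(2D\left(IG(x,\lambda)\Vert IG(\mu,\lambda)\right)\right)^{1/2}, & x<\mu,\\ +\left(2D\left(IG(x,\lambda)\Vert IG(\mu,\lambda)\right)\right)^{1/2}, & x\ge\mu,\end{cases}$$ where $D(P\Vert Q)=\int\ln\frac{dP}{dQ}\,dP$ is the information divergence. For $x=0$ one sets $G_{IG(\mu,\lambda)}(0)=-\infty$ (the limit as $x\downarrow0$) and $\Phi(-\infty)=0$. *)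

(* Defs.v *)
From HB Require Import structures.
From mathcomp Require Import all_boot all_order all_algebra.
From mathcomp Require Import interval_inference.
From mathcomp Require Import all_classical all_reals all_analysis.
From mathcomp Require Import measurable_realfun.
From mathcomp Require Import ring lra.

Set Implicit Arguments.
Unset Strict Implicit.
Unset Printing Implicit Defensive.

Import Order.TTheory GRing.Theory Num.Theory.
Import numFieldNormedType.Exports.

Local Open Scope classical_set_scope.
Local Open Scope ring_scope.

Definition ig_pdf {R : realType} (m l x : R) : R :=
  if 0 < x then
    Num.sqrt (l / (2 * pi * x ^+ 3)) *
    expR (- l * (x - m) ^+ 2 / (2 * m ^+ 2 * x))
  else 0.

(* The Dirac branch is a junk value making [ig_prob m l] a probability measure
   for all real parameters; it is never used when m and l are positive. *)
Definition ig_prob {R : realType} (m l : R) : set R -> \bar R :=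
  fun V => if (0 < m) && (0 < l)
           then (\int[lebesgue_measure]_(x in V) (ig_pdf m l x)%:E)%E
           else \d_(0 : R) V.

(* With u, v = sqrt l * (sqrt x / m -/+ 1 / sqrt x), the function
   Phi u - exp (2 l / m) * Phi v is a primitive of the density on (0, +oo). *)
Section ig_total_mass.
Context {R : realType}.
Variables m l : R.
Hypotheses (m0 : 0 < m) (l0 : 0 < l).
Notation mu := (@lebesgue_measure R).
Notation phi := (normal_pdf (0 : R) 1).

Let Phi (t : R) : R := (\int[mu]_(s in `]-oo, t]) phi s)%R.

Let is_derive_Phi (t : R) : is_derive t 1 Phi (phi t).
Proof.
have int u : mu.-integrable [set` Interval -oo%O (BRight u)] (EFin \o phi).
  by apply: integrableS (integrable_normal_pdf 0 1).
have [] := @continuous_FTC1 R phi -oo%O t (t + 1) _ (int _).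
- by rewrite ltrDl.
- by rewrite ltNyr.
- exact/continuous_normal_pdf/oner_neq0.
by move=> dP PE; apply: DeriveDef => //; rewrite -derive1E.
Qed.

Let idR : measurableTypeR R -> R := idfun.
#[local] HB.instance Definition _ :=
  @isMeasurableFun.Build _ _ _ _ idR (@measurable_id _ _ setT).

Let cvg_Phiy : Phi t @[t --> +oo] --> (1 : R).
Proof. exact: (fine_cvg (cvg_cdfy1 (idR : {RV (normal_prob (0:R) 1) >-> R}))). Qed.

Let cvg_PhiNy : Phi t @[t --> -oo] --> (0 : R).
Proof. exact: (fine_cvg (cvg_cdfNy0 (idR : {RV (normal_prob (0:R) 1) >-> R}))). Qed.

Let u (x : R) : R := Num.sqrt l * (Num.sqrt x / m - (Num.sqrt x)^-1).
Let v (x : R) : R := Num.sqrt l * (Num.sqrt x / m + (Num.sqrt x)^-1).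
Let c := expR (2 * l / m).
Let F x := Phi (u x) - c * Phi (v x).

Let sl0 : 0 < Num.sqrt l. Proof. by rewrite sqrtr_gt0. Qed.

Let sqrtP (x : R) : 0 < x -> exists2 s, 0 < s & x = s ^+ 2.
Proof.
by move=> x0; exists (Num.sqrt x); rewrite ?sqrtr_gt0// sqr_sqrtr// ltW.
Qed.

Let pdf_u (x : R) : 0 < x ->
  ig_pdf m l x = Num.sqrt l * (x * Num.sqrt x)^-1 * phi (u x).
Proof.
move=> x0; rewrite /ig_pdf x0 normal_pdfE ?oner_neq0//.
have sx0 : 0 < Num.sqrt x by rewrite sqrtr_gt0.
rewrite /= /normal_peak /normal_fun [RHS]mulrA; congr (_ * expR _).
  rewrite sqrtrM ?ltW// -[RHS]mulrA; congr (_ * _).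
  rewrite expr1n mul1r -(mulr_natl pi).
  rewrite sqrtrV; last by rewrite !mulr_ge0 ?exprn_ge0 ?pi_ge0 ?ltW.
  rewrite -invfM; congr (_^-1).
  rewrite sqrtrM; last by rewrite mulr_ge0 ?pi_ge0.
  rewrite mulrC; congr (_ * _).
  by rewrite exprSr sqrtrM ?sqr_ge0// sqrtr_sqr gtr0_norm.
rewrite subr0 /u exprMn sqr_sqrtr; last exact: ltW.
have [s s0 xE] := sqrtP x0.
have -> : Num.sqrt x = s by rewrite xE sqrtr_sqr gtr0_norm.
rewrite expr1n xE.
by field; rewrite !gt_eqF.
Qed.

Let phi_uv (x : R) : 0 < x -> phi (u x) = c * phi (v x).
Proof.
move=> x0; rewrite normal_pdfE ?oner_neq0//= mulrCA; congr (_ * _).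
have sx0 : 0 < Num.sqrt x by rewrite sqrtr_gt0.
rewrite /normal_fun /c -expRD; congr expR.
rewrite !subr0 /u /v !exprMn sqr_sqrtr; last exact: ltW.
by rewrite expr1n; field; rewrite !gt_eqF.
Qed.

Let is_derive_u (x : R) : 0 < x -> is_derive x 1 u
  (Num.sqrt l * ((2 * Num.sqrt x)^-1 / m + (2 * x * Num.sqrt x)^-1)).
Proof.
move=> x0; have ds := is_derive1_sqrt x0.
have sn0 : Num.sqrt x != 0 by rewrite gt_eqF// sqrtr_gt0.
have di := is_deriveV sn0 ds.
have [s s0 xE] := sqrtP x0.
have sE : Num.sqrt x = s by rewrite xE sqrtr_sqr gtr0_norm.
apply: is_derive_eq; rewrite /GRing.scale/= sE xE.
by field; rewrite !gt_eqF.
Qed.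

Let is_derive_v (x : R) : 0 < x -> is_derive x 1 v
  (Num.sqrt l * ((2 * Num.sqrt x)^-1 / m - (2 * x * Num.sqrt x)^-1)).
Proof.
move=> x0; have ds := is_derive1_sqrt x0.
have sn0 : Num.sqrt x != 0 by rewrite gt_eqF// sqrtr_gt0.
have di := is_deriveV sn0 ds.
have [s s0 xE] := sqrtP x0.
have sE : Num.sqrt x = s by rewrite xE sqrtr_sqr gtr0_norm.
apply: is_derive_eq; rewrite /GRing.scale/= sE xE.
by field; rewrite !gt_eqF.
Qed.

Let is_derive_F (x : R) : 0 < x -> is_derive x 1 F (ig_pdf m l x).
Proof.
move=> x0; have sx0 : 0 < Num.sqrt x by rewrite sqrtr_gt0.
have dPu := is_derive1_comp (is_derive_Phi (u x)) (is_derive_u x0).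
have dPv := is_derive1_comp (is_derive_Phi (v x)) (is_derive_v x0).
rewrite /F; apply: is_derive_eq.
rewrite pdf_u// phi_uv// /GRing.scale/=.
by field; rewrite !gt_eqF.
Qed.

Let continuous_ig_pdf (x : R) : 0 < x -> {for x, continuous (ig_pdf m l)}.
Proof.
move=> x0; have sx0 : 0 < Num.sqrt x by rewrite sqrtr_gt0.
rewrite /prop_for /continuous_at pdf_u//.
have : (Num.sqrt l * (y * Num.sqrt y)^-1 * phi (u y)) @[y --> x] -->
    Num.sqrt l * (x * Num.sqrt x)^-1 * phi (u x).
  apply: cvgM.
    apply: cvgM; first exact: cvg_cst.
    apply: cvgV; first by rewrite mulf_neq0 ?gt_eqF.
    by apply: cvgM; [exact: cvg_id|exact: sqrt_continuous].
  apply: continuous_comp; last exact/continuous_normal_pdf/oner_neq0.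
  apply: differentiable_continuous; apply/derivable1_diffP.
  by have [] := is_derive_u x0.
apply: cvg_trans; apply: near_eq_cvg.
by near=> y; rewrite /= pdf_u//; near: y; exact: lt_nbhsr.
Unshelve. all: by end_near. Qed.

Let cvg_uy : u x @[x --> +oo] --> +oo.
Proof.
apply/cvgryPge => A.
set B := m * (`|A| / Num.sqrt l + 1).
have B0 : 0 <= B.
  by rewrite /B mulr_ge0 ?(ltW m0)// addr_ge0// divr_ge0// sqrtr_ge0.
near=> x.
have x1 : 1 <= x by near: x; exact: nbhs_pinfty_ge.
have x0 : 0 < x by exact: lt_le_trans x1.
have xB : B ^+ 2 <= x by near: x; exact: (nbhs_pinfty_ge (num_real _)).
have s1 : 1 <= Num.sqrt x by rewrite -sqrtr1 ler_wsqrtr.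
have sB : B <= Num.sqrt x by rewrite -[B]ger0_norm// -sqrtr_sqr ler_wsqrtr.
have sV : (Num.sqrt x)^-1 <= 1 by rewrite invf_le1// (lt_le_trans _ s1).
rewrite (le_trans (ler_norm A))//.
rewrite -ler_pdivrMl// mulrC lerBrDr (@le_trans _ _ (`|A| / Num.sqrt l + 1))//.
  by rewrite lerD2l.
by rewrite ler_pdivlMr// mulrC.
Unshelve. all: by end_near. Qed.

Let cvg_vy : v x @[x --> +oo] --> +oo.
Proof.
apply/cvgryPge => A; move/cvgryPge : cvg_uy => /(_ A).
apply: filterS => x /le_trans; apply.
rewrite ler_pM2l// lerD2l (@le_trans _ _ 0)// ?oppr_le0 invr_ge0 sqrtr_ge0//.
Qed.

Let sqrtV_near0 A : \forall x \near (0 : R)^'+, A <= (Num.sqrt x)^-1.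
Proof.
near=> x; have x0 : 0 < x by near: x; exact: nbhs_right_gt.
have sx0 : 0 < Num.sqrt x by rewrite sqrtr_gt0.
have B0 : 0 < `|A| + 1 by rewrite ltr_wpDl.
apply: (@le_trans _ _ (`|A| + 1)); first by rewrite (le_trans (ler_norm _))// lerDl.
rewrite -[leLHS]invrK lef_pV2 ?posrE ?invr_gt0//.
have -> : (`|A| + 1)^-1 = Num.sqrt ((`|A| + 1)^-1 ^+ 2).
  by rewrite sqrtr_sqr [RHS]ger0_norm ?invr_ge0 ?(ltW B0).
rewrite ler_wsqrtr//.
by near: x; apply: nbhs_right_le; rewrite exprn_gt0// invr_gt0.
Unshelve. all: by end_near. Qed.

Let cvg_u0 : u x @[x --> (0 : R)^'+] --> -oo.
Proof.
apply/cvgrNyPle => A; near=> x.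
have x1 : x <= 1 by near: x; exact: nbhs_right_le.
have s1 : Num.sqrt x <= 1 by rewrite -sqrtr1 ler_wsqrtr.
have sV : m^-1 + `|A| / Num.sqrt l <= (Num.sqrt x)^-1.
  by near: x; exact: sqrtV_near0.
have sm : Num.sqrt x / m <= m^-1 by rewrite ler_piMl// invr_ge0 ltW.
rewrite (@le_trans _ _ (- `|A|))//; last by rewrite lerNl -normrN ler_norm.
rewrite -ler_pdivlMl// mulrN mulrC; lra.
Unshelve. all: by end_near. Qed.

Let cvg_v0 : v x @[x --> (0 : R)^'+] --> +oo.
Proof.
apply/cvgryPge => A; near=> x.
have sV : `|A| / Num.sqrt l <= (Num.sqrt x)^-1.
  by near: x; exact: sqrtV_near0.
rewrite (le_trans (ler_norm A))//.
rewrite -ler_pdivrMl// mulrC (le_trans sV)// lerDr divr_ge0 ?sqrtr_ge0 ?ltW//.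
Unshelve. all: by end_near. Qed.

Let cvg_Fy : F x @[x --> +oo] --> 1 - c * 1.
Proof.
apply: cvgB; first exact: cvg_comp cvg_uy cvg_Phiy.
by apply: cvgM; [exact: cvg_cst|exact: cvg_comp cvg_vy cvg_Phiy].
Qed.

Let cvg_F0 : F x @[x --> (0 : R)^'+] --> 0 - c * 1.
Proof.
apply: cvgB; first exact: cvg_comp cvg_u0 cvg_PhiNy.
by apply: cvgM; [exact: cvg_cst|exact: cvg_comp cvg_v0 cvg_Phiy].
Qed.

Lemma ig_pdf_ge0 x : 0 <= ig_pdf m l x.
Proof.
by rewrite /ig_pdf; case: ifP => // _; rewrite mulr_ge0 ?sqrtr_ge0 ?expR_ge0.
Qed.

Let ig_pdf_restrict : ig_pdf m l = ig_pdf m l \_ `]0, +oo[.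
Proof.
apply/funext => x; rewrite patchE; case: ifPn => //.
rewrite notin_setE/= in_itv/= andbT => /negP/negbTE x0.
by rewrite /ig_pdf x0.
Qed.

Lemma measurable_ig_pdf : measurable_fun [set: R] (ig_pdf m l).
Proof.
rewrite ig_pdf_restrict; apply/(measurable_restrictT _ _).1 => //.
apply: open_continuous_measurable_fun => //.
by move=> x; rewrite inE/= in_itv/= andbT; exact: continuous_ig_pdf.
Qed.

Let integral_ig_pdf_ge (a : R) : 0 < a ->
  (\int[mu]_(x in `[a, +oo[) (ig_pdf m l x)%:E = (1 - c * 1)%:E - (F a)%:E)%E.
Proof.
move=> a0; apply: ge0_continuous_FTC2y => //.
- by move=> x _; exact: ig_pdf_ge0.
- apply/continuous_within_itvcyP; split.
    move=> x; rewrite in_itv/= andbT => ax.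
    by apply: continuous_ig_pdf; exact: lt_trans ax.
  by apply: cvg_at_right_filter; exact: continuous_ig_pdf.
- by move=> x ax; have [] := is_derive_F (lt_trans a0 ax).
- apply: cvg_at_right_filter.
  apply: differentiable_continuous; apply/derivable1_diffP.
  by have [] := is_derive_F a0.
- move=> x; rewrite in_itv/= andbT => ax.
  by rewrite derive1E; have [_ ->] := is_derive_F (lt_trans a0 ax).
Qed.

Lemma integral_ig_pdf : (\int[mu]_x (ig_pdf m l x)%:E = 1)%E.
Proof.
have -> : (\int[mu]_x (ig_pdf m l x)%:E =
           \int[mu]_(x in `]0%R, +oo[) (ig_pdf m l x)%:E)%E.
  rewrite [RHS]integral_mkcond; apply: eq_integral => x _.
  by rewrite {1}ig_pdf_restrict restrict_EFin.
pose E n : set R := `[n.+1%:R^-1, +oo[%classic.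
have EU : `]0%R, +oo[%classic = \bigcup_n E n.
  apply/seteqP; split => x /=.
    rewrite in_itv/= andbT => x0; exists (Num.truncn x^-1) => //=.
    by rewrite /E/= in_itv/= andbT invf_ple ?posrE// ltW// truncnS_gt.
  by move=> [n _]; rewrite /E/= !in_itv/= !andbT; exact: lt_le_trans.
have mE : measurable_fun [set: R] (EFin \o ig_pdf m l).
  by apply/measurable_EFinP; exact: measurable_ig_pdf.
rewrite EU.
have h : (\int[mu]_(x in E n) (ig_pdf m l x)%:E)%E @[n --> \oo] -->
         (\int[mu]_(x in \bigcup_n E n) (ig_pdf m l x)%:E)%E.
  apply: ge0_nondecreasing_set_cvg_integral => //.
  - move=> i j ij; apply/subsetPset => x; rewrite /E/= !in_itv/= !andbT.
    by apply: le_trans; rewrite lef_pV2 ?posrE// ler_nat.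
  - by move=> i; exact: measurable_itv.
  - by move=> i; exact: measurable_funTS.
  - by move=> i x _; rewrite lee_fin ig_pdf_ge0.
have h1 : (\int[mu]_(x in E n) (ig_pdf m l x)%:E)%E @[n --> \oo] --> 1%:E.
  under eq_fun do rewrite integral_ig_pdf_ge ?invr_gt0// -EFinB.
  apply: cvg_EFin; first exact: nearW.
  have one : 1 = (1 - c * 1) - (0 - c * 1) :> R by ring.
  rewrite [X in _ --> X]one.
  apply: cvgB; first exact: cvg_cst.
  move/cvg_at_rightP : cvg_F0; apply; split => [n|]; first by rewrite invr_gt0.
  exact: cvg_harmonic.
exact: cvg_unique h h1.
Qed.

End ig_total_mass.

Section ig_probability.
Context {R : realType}.
Variables m l : R.
Notation mu := (@lebesgue_measure R).

Let ig0 : ig_prob m l set0 = 0%E.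
Proof.
by rewrite /ig_prob; case: ifPn => _; rewrite ?integral_set0 ?measure0.
Qed.

Let ig_ge0 A : (0 <= ig_prob m l A)%E.
Proof.
rewrite /ig_prob; case: ifPn => // _.
by apply: integral_ge0 => x _; rewrite lee_fin ig_pdf_ge0.
Qed.

Let ig_semi_sigma_additive : semi_sigma_additive (ig_prob m l).
Proof.
rewrite /ig_prob; case: (boolP ((0 < m) && (0 < l))) => [/andP[m0 l0]|_];
  last exact: measure_semi_sigma_additive.
move=> A mA tA mUA /=.
have mf : measurable_fun [set: R] (EFin \o ig_pdf m l).
  by apply/measurable_EFinP; exact: measurable_ig_pdf.
rewrite ge0_integral_bigcup//=; last 2 first.
- exact: measurable_funTS.
- by move=> x _; rewrite lee_fin ig_pdf_ge0.
apply: is_cvg_ereal_nneg_natsum_cond => n _ _.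
by apply: integral_ge0 => x _; rewrite lee_fin ig_pdf_ge0.
Qed.

HB.instance Definition _ := isMeasure.Build _ _ _
  (ig_prob m l) ig0 ig_ge0 ig_semi_sigma_additive.

Let ig_setT : ig_prob m l [set: _] = 1%E.
Proof.
rewrite /ig_prob; case: ifPn => [/andP[m0 l0]|_]; first exact: integral_ig_pdf.
by rewrite diracT.
Qed.

HB.instance Definition _ :=
  @Measure_isProbability.Build _ _ R (ig_prob m l) ig_setT.

End ig_probability.

Definition info_divergence d (T : measurableType d) (R : realType)
    (P Q : probability T R) : \bar R :=
  if `[< P `<< Q >]
  then (\int[P]_x lne (Radon_Nikodym (charge_of_finite_measure P) Q x))%E
  else +oo%E.

(* Used for x >= 0 only; at x = 0 it takes the limit value -oo. *)
Definition ig_signed_loglik {R : realType} (m l x : R) : \bar R :=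
  if x <= 0 then -oo%E
  else if x < m then
    (- sqrte (2%:E * info_divergence (ig_prob x l) (ig_prob m l)))%E
  else sqrte (2%:E * info_divergence (ig_prob x l) (ig_prob m l))%E.

(* At y = -oo the set is empty, whence the value 0. *)
Definition std_normal_cdf {R : realType} (y : \bar R) : \bar R :=
  normal_prob (0 : R) 1 [set t : R | (t%:E <= y)%E].

(* Main.v *)
Require Import Defs.
From HB Require Import structures.
From mathcomp Require Import all_boot all_order all_algebra.
From mathcomp Require Import interval_inference.
From mathcomp Require Import all_classical all_reals all_analysis.
From mathcomp Require Import measurable_realfun.
From mathcomp Require Import ring lra.

(* The density of IG(x, l) with respect to IG(m, l) is exp (a w + b), so the
   divergence only involves the mean of IG(x, l) and equals
   l (x - m)^2 / (2 m^2 x).  Hence the signed log-likelihood is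
   u x = sqrt l * (sqrt x / m - 1 / sqrt x).  With
   v x = sqrt l * (sqrt x / m + 1 / sqrt x) and c = exp (2 l / m), the function
   Phi u - c Phi v is a primitive of the density of IG(m, l), and
   m (Phi u + c Phi v) is a primitive of w times that density.  The latter gives
   the mean; the former gives Pr (W <= x) = Phi (u x) + c (1 - Phi (v x)), which
   is at least Phi (u x). *)

Set Implicit Arguments.
Unset Strict Implicit.
Unset Printing Implicit Defensive.

Import Order.TTheory GRing.Theory Num.Theory.
Import numFieldNormedType.Exports.

Local Open Scope classical_set_scope.
Local Open Scope ring_scope.

(** * Measures given by a density, and their Radon-Nikodym derivatives *)

Section density.
Context d (T : measurableType d) (R : realType).
Local Open Scope ereal_scope.

Lemma null_dominates_density (nu mu : {measure set T -> \bar R})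
    (f : T -> \bar R) : measurable_fun [set: T] f ->
  (forall A, measurable A -> nu A = \int[mu]_(x in A) f x) -> nu `<< mu.
Proof.
move=> mf nuE; apply/null_content_dominatesP => A mA muA0.
by rewrite nuE//; apply: null_set_integral => //; exact: measurable_funTS.
Qed.

Variables (nu : {finite_measure set T -> \bar R})
  (mu : {sigma_finite_measure set T -> \bar R}) (f : T -> \bar R).
Hypotheses (mf : measurable_fun [set: T] f)
  (nuE : forall A, measurable A -> nu A = \int[mu]_(x in A) f x).

Lemma ae_eq_Radon_Nikodym_density :
  ae_eq mu [set: T] (Radon_Nikodym (charge_of_finite_measure nu) mu) f.
Proof.
have numu := null_dominates_density mf nuE.
apply: integral_ae_eq => //; first exact: Radon_Nikodym_integrable.
by move=> A _ mA; rewrite -Radon_Nikodym_integral// -nuE.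
Qed.

Lemma integral_density (h : T -> \bar R) : nu.-integrable [set: T] h ->
  \int[nu]_x h x = \int[mu]_x (h x * f x).
Proof.
move=> ih; have numu := null_dominates_density mf nuE.
rewrite -(Radon_Nikodym_change_of_variables numu)//.
have mh := measurable_int _ ih.
apply: ae_eq_integral => //.
- exact: emeasurable_funM.
- exact: emeasurable_funM.
- exact/ae_eqe_mul2l/ae_eq_Radon_Nikodym_density.
Qed.

(** Complements the integrable case: integrability of the identity under the inverse Gaussian law is
    itself obtained from this version. *)
Lemma ge0_integral_density (h : T -> \bar R) :
  measurable_fun [set: T] h -> (forall x, 0 <= h x) ->
  \int[nu]_x h x = \int[mu]_x (h x * f x).
Proof.
move=> mh h0; have numu := null_dominates_density mf nuE.
rewrite -(Radon_Nikodym_SigmaFinite.change_of_variables numu)//.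
have mRN : measurable_fun [set: T] (Radon_Nikodym_SigmaFinite.f nu mu).
  exact/measurable_int/(Radon_Nikodym_SigmaFinite.f_integrable numu).
apply: ae_eq_integral => //; [exact/emeasurable_funM..|].
apply: ae_eqe_mul2l.
apply: ae_eq_trans (ae_eq_Radon_Nikodym_SigmaFinite numu measurableT) _.
exact: ae_eq_Radon_Nikodym_density.
Qed.

End density.

(** * Information divergence through an explicit positive density *)

Lemma measurable_lne (R : realType) : measurable_fun [set: \bar R] (@lne R).
Proof.
(* [fine] sends [-oo] to 0, so the test [fine x <= 0] also catches [-oo]. *)
have -> : @lne R = fun x => if x == +oo%E then +oo%E
    else if fine x <= 0 then -oo%E else (ln (fine x))%:E.
  by apply/funext => -[r| |] //=; rewrite lexx.
apply: measurable_fun_ifT => //.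
  apply: (measurable_fun_bool true); rewrite setTI.
  rewrite (_ : _ @^-1` _ = [set +oo%E]); first exact: emeasurable_set1.
  by apply/seteqP; split => x /= /eqP.
apply: measurable_fun_ifT => //.
  by apply: measurable_fun_ler => //; exact: fine_measurable.
apply/measurable_EFinP/(measurableT_comp (@measurable_ln R)).
exact: fine_measurable.
Qed.

Lemma info_divergence_density d (T : measurableType d) (R : realType)
    (P Q : probability T R) (g : T -> R) :
  measurable_fun [set: T] g -> (forall x, 0 < g x) ->
  (forall A, measurable A -> P A = \int[Q]_(x in A) (g x)%:E)%E ->
  info_divergence P Q = (\int[P]_x (ln (g x))%:E)%E.
Proof.
move=> mg g0 PE.
have mg' : measurable_fun [set: T] (EFin \o g) by exact/measurable_EFinP.
have PQ := null_dominates_density mg' PE.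
rewrite /info_divergence asboolT//.
(* The derivative equals [g] only [Q]-almost everywhere; domination carries this over to [P], the
   integrating measure. *)
have RNg := null_dominates_ae_eq measurableT PQ
  (ae_eq_Radon_Nikodym_density mg' PE).
apply: ae_eq_integral => //.
- apply: measurableT_comp; first exact: measurable_lne.
  by apply: measurable_int; exact: Radon_Nikodym_integrable.
- exact/measurable_EFinP/(measurableT_comp (@measurable_ln R)).
- by apply: filterS RNg => x /= /(_ I) -> _; rewrite lne_EFin.
Qed.

(** * The standard normal distribution function *)

Section std_normal.
Context {R : realType}.
Notation mu := (@lebesgue_measure R).
Notation phi := (normal_pdf (0 : R) 1).

Definition Phi (t : R) : R := (\int[mu]_(s in `]-oo, t]) phi s)%R.

Let integrable_phi (u : R) :
  mu.-integrable [set` Interval -oo%O (BRight u)] (EFin \o phi).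
Proof. by apply: integrableS (integrable_normal_pdf 0 1). Qed.

Lemma EFin_Phi (t : R) : (Phi t)%:E = normal_prob (0 : R) 1 `]-oo, t].
Proof.
by rewrite /Phi /Rintegral fineK//; exact/integrable_fin_num/integrable_phi.
Qed.

Lemma std_normal_cdfE (t : R) : std_normal_cdf t%:E = (Phi t)%:E.
Proof.
rewrite EFin_Phi /std_normal_cdf set_itvE.
by congr (normal_prob _ _ _); apply/funext => s; rewrite /= lee_fin.
Qed.

Lemma is_derive_Phi (t : R) : is_derive t 1 Phi (phi t).
Proof.
have [] := @continuous_FTC1 R phi -oo%O t (t + 1) _ (integrable_phi _).
- by rewrite ltrDl.
- by rewrite ltNyr.
- exact/continuous_normal_pdf/oner_neq0.
move=> dP PE; split; first exact: dP.
by rewrite -derive1E; exact: PE.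
Qed.

Lemma le_Phi : {homo Phi : s t / s <= t}.
Proof.
move=> s t st; rewrite -lee_fin !EFin_Phi; apply: le_measure.
- by rewrite inE.
- by rewrite inE.
- exact: subset_itvl.
Qed.

(** Under the normal law the identity is a random variable with distribution function [Phi], so the
    general limits at both infinities apply. *)
Let idR : measurableTypeR R -> R := idfun.
#[local] HB.instance Definition _ :=
  @isMeasurableFun.Build _ _ _ _ idR (@measurable_id _ _ setT).

Lemma cvg_Phiy : Phi t @[t --> +oo] --> (1 : R).
Proof.
exact: (fine_cvg (cvg_cdfy1 (idR : {RV (normal_prob (0:R) 1) >-> R}))).
Qed.

Lemma cvg_PhiNy : Phi t @[t --> -oo] --> (0 : R).
Proof.
exact: (fine_cvg (cvg_cdfNy0 (idR : {RV (normal_prob (0:R) 1) >-> R}))).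
Qed.

End std_normal.

(** * Primitives of the density and of its first-moment integrand *)

Section ig_primitives.
Context {R : realType}.
Variables m l : R.
Hypotheses (m0 : 0 < m) (l0 : 0 < l).
Notation mu := (@lebesgue_measure R).
Notation phi := (normal_pdf (0 : R) 1).

(* [ig_arg (-1)] and [ig_arg 1] are the functions u and v. *)
Definition ig_arg (e x : R) : R :=
  Num.sqrt l * (Num.sqrt x / m + e / Num.sqrt x).
Local Notation u := (ig_arg (-1)).
Local Notation v := (ig_arg 1).
Local Notation c := (expR (2 * l / m)).

Let sl0 : 0 < Num.sqrt l. Proof. by rewrite sqrtr_gt0. Qed.

(** Writing [x] as a square makes the expressions in [Num.sqrt x] rational, within reach of
    [field]. *)
Let sqrtP (x : R) : 0 < x -> exists2 s : R, 0 < s & x = s ^+ 2.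
Proof.
by move=> x0; exists (Num.sqrt x); rewrite ?sqrtr_gt0// sqr_sqrtr// ltW.
Qed.

(** Used twice: the exponent of the density is -u^2/2, and u^2 is twice the divergence. *)
Lemma sqr_ig_argN1 (x : R) : 0 < x ->
  u x ^+ 2 = l * (x - m) ^+ 2 / (m ^+ 2 * x).
Proof.
move=> /sqrtP[s s0 ->]; rewrite /ig_arg sqrtr_sqr gtr0_norm//.
rewrite exprMn sqr_sqrtr ?ltW//; field; rewrite !gt_eqF//.
Qed.

Lemma ig_argN1_ge0 (x : R) : 0 < x -> (0 <= u x) = (m <= x).
Proof.
move=> /sqrtP[s s0 ->]; rewrite /ig_arg sqrtr_sqr gtr0_norm// pmulr_rge0//.
have -> : s / m + -1 / s = (s ^+ 2 - m) / (m * s) by field; rewrite !gt_eqF.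
by rewrite pmulr_lge0 ?subr_ge0// invr_gt0 mulr_gt0.
Qed.

Lemma ig_pdfE (x : R) : 0 < x ->
  ig_pdf m l x = Num.sqrt l * (x * Num.sqrt x)^-1 * phi (u x).
Proof.
move=> x0; have [s s0 xE] := sqrtP x0.
rewrite /ig_pdf x0 normal_pdfE ?oner_neq0//= /normal_peak /normal_fun.
rewrite [RHS]mulrA.
congr (_ * expR _); last first.
  by rewrite subr0 expr1n sqr_ig_argN1//; field; rewrite !gt_eqF.
rewrite xE sqrtr_sqr gtr0_norm// sqrtrM ?ltW// -[RHS]mulrA; congr (_ * _).
have pi2 : 0 < 2 * pi :> R by rewrite mulr_gt0// pi_gt0.
rewrite expr1n mul1r -(mulr_natl pi) sqrtrV; last first.
  by rewrite mulr_ge0 ?exprn_ge0 ?ltW.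
rewrite sqrtrM ?ltW// invfM mulrC; congr (_^-1 * _).
rewrite -exprM (_ : (2 * 3 = 3 * 2)%N)// exprM sqrtr_sqr gtr0_norm ?exprn_gt0//.
by rewrite exprSr.
Qed.

(** Holds because v^2 - u^2 = 4 l / m. *)
Lemma normal_pdf_ig_arg (x : R) : 0 < x -> phi (u x) = c * phi (v x).
Proof.
move=> /sqrtP[s s0 ->]; rewrite normal_pdfE ?oner_neq0//= mulrCA.
congr (_ * _); rewrite /normal_fun -expRD; congr expR.
rewrite !subr0 /ig_arg !exprMn sqr_sqrtr ?ltW// sqrtr_sqr gtr0_norm// expr1n.
by field; rewrite !gt_eqF.
Qed.

Lemma is_derive_ig_arg (e x : R) : 0 < x -> is_derive x 1 (ig_arg e)
  (Num.sqrt l * ((2 * Num.sqrt x)^-1 / m - e * (2 * x * Num.sqrt x)^-1)).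
Proof.
move=> x0; have ds := is_derive1_sqrt x0.
have sn0 : Num.sqrt x != 0 by rewrite gt_eqF// sqrtr_gt0.
have di := is_deriveV sn0 ds.
have [s s0 xE] := sqrtP x0.
have sE : Num.sqrt x = s by rewrite xE sqrtr_sqr gtr0_norm.
apply: is_derive_eq; rewrite /GRing.scale/= sE xE.
by field; rewrite !gt_eqF.
Qed.

Let is_derive_Phi_ig_arg (e x : R) (x0 : 0 < x) :=
  is_derive1_comp (is_derive_Phi (ig_arg e x)) (is_derive_ig_arg e x0).

(** As phi(u) = c phi(v), the derivative is phi(u) (u' - v'), and u' - v' = sqrt l / (x sqrt x). *)
Lemma is_derive_ig_cdf (x : R) : 0 < x ->
  is_derive x 1 (fun y => Phi (u y) - c * Phi (v y)) (ig_pdf m l x).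
Proof.
move=> x0; have sx0 : 0 < Num.sqrt x by rewrite sqrtr_gt0.
have dPu := is_derive_Phi_ig_arg (-1) x0.
have dPv := is_derive_Phi_ig_arg 1 x0.
apply: is_derive_eq; rewrite ig_pdfE// normal_pdf_ig_arg// /GRing.scale/=.
by field; rewrite !gt_eqF.
Qed.

(** Here the derivative is m phi(u) (u' + v'), with u' + v' = sqrt l / (m sqrt x). *)
Lemma is_derive_ig_mean (x : R) : 0 < x ->
  is_derive x 1 (fun y => m * (Phi (u y) + c * Phi (v y))) (x * ig_pdf m l x).
Proof.
move=> x0; have sx0 : 0 < Num.sqrt x by rewrite sqrtr_gt0.
have dPu := is_derive_Phi_ig_arg (-1) x0.
have dPv := is_derive_Phi_ig_arg 1 x0.
apply: is_derive_eq; rewrite ig_pdfE// normal_pdf_ig_arg// /GRing.scale/=.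
by field; rewrite !gt_eqF.
Qed.

Lemma continuous_ig_pdf (x : R) : 0 < x -> {for x, continuous (ig_pdf m l)}.
Proof.
move=> x0; have sx0 : 0 < Num.sqrt x by rewrite sqrtr_gt0.
rewrite /prop_for /continuous_at ig_pdfE//.
have : (Num.sqrt l * (y * Num.sqrt y)^-1 * phi (u y)) @[y --> x] -->
    Num.sqrt l * (x * Num.sqrt x)^-1 * phi (u x).
  apply: cvgM.
    apply: cvgM; first exact: cvg_cst.
    apply: cvgV; first by rewrite mulf_neq0 ?gt_eqF.
    by apply: cvgM; [exact: cvg_id|exact: sqrt_continuous].
  apply: continuous_comp; last exact/continuous_normal_pdf/oner_neq0.
  apply: differentiable_continuous; apply/derivable1_diffP.
  by have [] := is_derive_ig_arg (-1) x0.
apply: cvg_trans; apply: near_eq_cvg.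
by near=> y; rewrite /= ig_pdfE//; near: y; exact: lt_nbhsr.
Unshelve. all: by end_near. Qed.

Let sqrt_ge_near_pinfty (A : R) : \forall x \near +oo, A <= Num.sqrt x.
Proof.
near=> x; apply: le_trans (ler_norm A) _; rewrite -sqrtr_sqr ler_wsqrtr//.
Unshelve. all: by end_near. Qed.

Let sqrtV_ge_near_0 (A : R) : \forall x \near (0 : R)^'+, A <= (Num.sqrt x)^-1.
Proof.
(* The threshold is x <= 1 / (A^2 + 1); the added 1 keeps it meaningful when [A] is 0. *)
have A2 : 0 < A ^+ 2 + 1 by rewrite ltr_wpDl ?sqr_ge0.
near=> x; have x0 : 0 < x by near: x; exact: nbhs_right_gt.
rewrite -sqrtrV ?(ltW x0)//; apply: le_trans (ler_norm A) _.
rewrite -sqrtr_sqr ler_wsqrtr//; apply: (@le_trans _ _ (A ^+ 2 + 1)).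
  by rewrite lerDl.
rewrite -[leLHS]invrK lef_pV2 ?posrE ?invr_gt0//.
by near: x; apply: nbhs_right_le; rewrite invr_gt0.
Unshelve. all: by end_near. Qed.

Lemma cvg_ig_argy (e : R) : `|e| <= 1 -> ig_arg e x @[x --> +oo] --> +oo.
Proof.
move=> e1; apply/cvgryPge => A; near=> x.
have s1 : 1 <= Num.sqrt x by near: x; exact: sqrt_ge_near_pinfty.
(* The [+ 1] absorbs [e / Num.sqrt x], which is at least -1 once [Num.sqrt x] is at least 1. *)
have sB : (A / Num.sqrt l + 1) * m <= Num.sqrt x.
  by near: x; exact: sqrt_ge_near_pinfty.
have sx0 : 0 < Num.sqrt x by exact: lt_le_trans s1.
have sV : `|e / Num.sqrt x| <= 1.
  rewrite normrM normfV (gtr0_norm sx0) ler_pdivrMr// mul1r.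
  exact: le_trans s1.
have sB' : A / Num.sqrt l + 1 <= Num.sqrt x / m by rewrite ler_pdivlMr.
rewrite -ler_pdivrMl// mulrC; move: sV; rewrite ler_norml => /andP[]; lra.
Unshelve. all: by end_near. Qed.

Lemma cvg_ig_arg10 : v x @[x --> (0 : R)^'+] --> +oo.
Proof.
apply/cvgryPge => A; near=> x.
have sV : A / Num.sqrt l <= (Num.sqrt x)^-1.
  by near: x; exact: sqrtV_ge_near_0.
rewrite /ig_arg -ler_pdivrMl// mulrC div1r (le_trans sV)// lerDr.
by rewrite divr_ge0 ?sqrtr_ge0 ?ltW.
Unshelve. all: by end_near. Qed.

Lemma cvg_ig_argN10 : u x @[x --> (0 : R)^'+] --> -oo.
Proof.
apply/cvgrNyPle => A; near=> x.
have x1 : x <= 1 by near: x; exact: nbhs_right_le.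
have s1 : Num.sqrt x <= 1 by rewrite -sqrtr1 ler_wsqrtr.
(* The term [m^-1] compensates [Num.sqrt x / m], which is at most [m^-1] for [x <= 1]. *)
have sV : m^-1 - A / Num.sqrt l <= (Num.sqrt x)^-1.
  by near: x; exact: sqrtV_ge_near_0.
have sm : Num.sqrt x / m <= m^-1 by rewrite ler_piMl// invr_ge0 ltW.
rewrite /ig_arg -ler_pdivlMl// mulrC mulN1r; lra.
Unshelve. all: by end_near. Qed.

(** The mass of [a, x] is Phi(u x) - Phi(u a) + c (Phi(v a) - Phi(v x)). For [a] near 0 the last
    bracket is nonnegative and Phi(u a) is at most [e], so a bounded interval suffices. *)
Lemma ig_cdf_ge (x : R) : 0 < x ->
  ((Phi (u x))%:E <= ig_prob m l `]-oo, x])%E.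
Proof.
move=> x0; apply/lee_addgt0Pr => e e0.
have h : \forall a \near (0 : R)^'+,
    [/\ 0 < a, a < x, v x <= v a & Phi (u a) <= e].
  near=> a; split; near: a.
  - exact: nbhs_right_gt.
  - exact: nbhs_right_lt.
  - by move/cvgryPge : cvg_ig_arg10; exact.
  - have := cvg_comp _ _ cvg_ig_argN10 cvg_PhiNy.
    move=> /cvgr0_norm_le/(_ _ e0); apply: filterS => a.
    exact/le_trans/ler_norm.
have [a [a0 ax vxa Pa]] := filter_ex h.
rewrite -leeBlDr// -EFinB.
apply: (@le_trans _ _ (ig_prob m l `[a, x])); last first.
  apply: le_measure; rewrite ?inE//.
  by move=> y /=; rewrite !in_itv/= => /andP[].
pose F (y : R) : R := Phi (u y) - c * Phi (v y).
have dF (y : R) : 0 < y -> is_derive y 1 F (ig_pdf m l y).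
  exact: is_derive_ig_cdf.
have cF (y : R) : 0 < y -> {for y, continuous F}.
  move=> y0; apply: differentiable_continuous; apply/derivable1_diffP.
  by have [] := dF _ y0.
rewrite /ig_prob m0 l0/= (@continuous_FTC2 _ _ F)//.
- rewrite -EFinB lee_fin /F.
  have : c * Phi (v x) <= c * Phi (v a) by rewrite ler_pM2l ?expR_gt0// le_Phi.
  move: Pa; move: (c * Phi (v x)) (c * Phi (v a)) (Phi (u x)) (Phi (u a)).
  by move=> p q r s; lra.
- apply: continuous_in_subspaceT => y.
  rewrite inE/= in_itv/= => /andP[ay _].
  by apply: continuous_ig_pdf; exact: lt_le_trans ay.
- split.
  + move=> y; rewrite in_itv/= => /andP[ay _].
    by have [] := dF _ (lt_trans a0 ay).
  + exact/cvg_at_right_filter/cF.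
  + exact/cvg_at_left_filter/cF.
- move=> y; rewrite in_itv/= => /andP[ay _].
  by rewrite derive1E; have [_ ->] := dF _ (lt_trans a0 ay).
Unshelve. all: by end_near. Qed.

(** Both u and v tend to +oo at +oo, so the primitive has limit m (1 + c) there. *)
Let ig_mean_ge (a : R) : 0 < a ->
  (\int[mu]_(x in `[a, +oo[) (x * ig_pdf m l x)%:E =
   (m * (1 + c * 1) - m * (Phi (u a) + c * Phi (v a)))%:E)%E.
Proof.
move=> a0; rewrite EFinB; pose F (y : R) : R := m * (Phi (u y) + c * Phi (v y)).
have dF (y : R) : 0 < y -> is_derive y 1 F (y * ig_pdf m l y).
  exact: is_derive_ig_mean.
apply: (@ge0_continuous_FTC2y _ _ F).
- by move=> x ax; rewrite mulr_ge0 ?ig_pdf_ge0// (le_trans (ltW a0)).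
- apply: continuous_in_subspaceT => y.
  rewrite inE/= in_itv/= andbT => ay.
  apply: cvgM; first exact: cvg_id.
  by apply: continuous_ig_pdf; exact: lt_le_trans ay.
- apply: cvgM; first exact: cvg_cst.
  apply: cvgD.
    by apply: cvg_comp cvg_Phiy; apply: cvg_ig_argy; rewrite normrN1.
  apply: cvgM; first exact: cvg_cst.
  by apply: cvg_comp cvg_Phiy; apply: cvg_ig_argy; rewrite normr1.
- by move=> x ax; have [] := dF _ (lt_trans a0 ax).
- apply: cvg_at_right_filter.
  apply: differentiable_continuous; apply/derivable1_diffP.
  by have [] := dF _ a0.
- move=> x; rewrite in_itv/= andbT => ax.
  by rewrite derive1E; have [_ ->] := dF _ (lt_trans a0 ax).
Qed.

Lemma integral_mul_ig_pdf : (\int[mu]_x (x * ig_pdf m l x)%:E = m%:E)%E.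
Proof.
have -> : (\int[mu]_x (x * ig_pdf m l x)%:E =
           \int[mu]_(x in `]0%R, +oo[) (x * ig_pdf m l x)%:E)%E.
  rewrite [RHS]integral_mkcond; apply: eq_integral => x _.
  rewrite patchE; case: ifPn => //; rewrite notin_setE/= in_itv/= andbT.
  by move=> /negP/negbTE x0; rewrite /ig_pdf x0 mulr0.
(* The primitive involves 1 / sqrt x, so 0 is approached through closed half-lines and monotone
   convergence. *)
pose E n : set R := `[n.+1%:R^-1, +oo[%classic.
have EU : `]0%R, +oo[%classic = \bigcup_n E n.
  apply/seteqP; split => x /=.
    rewrite in_itv/= andbT => x0; exists (Num.truncn x^-1) => //=.
    by rewrite /E/= in_itv/= andbT invf_ple ?posrE// ltW// truncnS_gt.
  by move=> [n _]; rewrite /E/= !in_itv/= !andbT; exact: lt_le_trans.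
have h : (\int[mu]_(x in E n) (x * ig_pdf m l x)%:E)%E @[n --> \oo] -->
         (\int[mu]_(x in \bigcup_n E n) (x * ig_pdf m l x)%:E)%E.
  apply: ge0_nondecreasing_set_cvg_integral => //.
  - move=> i j ij; apply/subsetPset => x; rewrite /E/= !in_itv/= !andbT.
    by apply: le_trans; rewrite lef_pV2 ?posrE// ler_nat.
  - by move=> i; exact: measurable_itv.
  - move=> i; apply/measurable_funTS/measurable_EFinP/measurable_funM => //.
    exact: measurable_ig_pdf.
  - move=> i x; rewrite /E/= in_itv/= andbT => ix.
    by rewrite lee_fin mulr_ge0 ?ig_pdf_ge0// (le_trans _ ix).
suff h1 : (\int[mu]_(x in E n) (x * ig_pdf m l x)%:E)%E @[n --> \oo] --> m%:E.
  by rewrite EU; exact: cvg_unique h h1.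
under eq_fun do rewrite ig_mean_ge ?invr_gt0//.
apply: cvg_EFin; first exact: nearW.
(* The mean appears as the limit of the primitive at +oo minus its limit at 0, where u tends to -oo
   and v to +oo. *)
rewrite [X in _ --> X](_ : m = m * (1 + c * 1) - m * (0 + c * 1)); last by ring.
apply: cvgB; first exact: cvg_cst.
suff : m * (Phi (u x) + c * Phi (v x)) @[x --> (0 : R)^'+] --> m * (0 + c * 1).
  move/cvg_at_rightP; apply; split => [n|]; first by rewrite invr_gt0.
  exact: cvg_harmonic.
apply: cvgM; first exact: cvg_cst.
apply: cvgD; first exact: cvg_comp cvg_ig_argN10 cvg_PhiNy.
apply: cvgM; first exact: cvg_cst.
exact: cvg_comp cvg_ig_arg10 cvg_Phiy.
Qed.

End ig_primitives.

(** * Integration against the inverse Gaussian law, and its mean *)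

Section ig_expectation.
Context {R : realType}.
Variables m l : R.
Hypotheses (m0 : 0 < m) (l0 : 0 < l).
Notation mu := (@lebesgue_measure R).

Let measurable_EFin_ig_pdf :
  measurable_fun [set: measurableTypeR R] (EFin \o ig_pdf m l).
Proof. by apply/measurable_EFinP; exact: measurable_ig_pdf. Qed.

(* [R] and [measurableTypeR R] carry the same sigma-algebra under different
   displays: [ig_prob] lives on the former, [lebesgue_measure] on the latter. *)
Let idR : R -> measurableTypeR R := idfun.
#[local] HB.instance Definition _ :=
  @isMeasurableFun.Build _ _ _ _ idR (@measurable_id _ _ setT).
Let ig_distr : probability (measurableTypeR R) R :=
  distribution (ig_prob m l) idR.

Let ig_distrE (A : set (measurableTypeR R)) : measurable A ->
  (ig_distr A = \int[mu]_(x in A) (EFin \o ig_pdf m l) x)%E.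
Proof.
by move=> mA; rewrite /ig_distr /= /distribution /pushforward /ig_prob m0 l0.
Qed.

Lemma ge0_integral_ig_prob (h : R -> \bar R) :
  measurable_fun [set: R] h -> (forall x, 0 <= h x)%E ->
  (\int[ig_prob m l]_x h x = \int[mu]_x (h x * (ig_pdf m l x)%:E))%E.
Proof.
move=> mh h0.
transitivity (\int[ig_distr]_x h x)%E.
  by rewrite ge0_integral_distribution.
exact: (ge0_integral_density measurable_EFin_ig_pdf ig_distrE).
Qed.

Lemma integral_ig_prob (h : R -> \bar R) :
  (ig_prob m l).-integrable [set: R] h ->
  (\int[ig_prob m l]_x h x = \int[mu]_x (h x * (ig_pdf m l x)%:E))%E.
Proof.
move=> ih; have mh := measurable_int _ ih.
transitivity (\int[ig_distr]_x h x)%E.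
  by rewrite integral_distribution.
apply: (integral_density measurable_EFin_ig_pdf ig_distrE).
exact: integrable_pushforward.
Qed.

Lemma integrable_ig_prob_id : (ig_prob m l).-integrable [set: R] EFin.
Proof.
apply/integrableP; split; first exact/measurable_EFinP.
rewrite ge0_integral_ig_prob//; last first.
  by apply: measurableT_comp => //; exact/measurable_EFinP.
under eq_integral.
  move=> x _.
  (* The absolute value drops because the density vanishes for [x <= 0]. *)
  have -> : (`|x%:E| * (ig_pdf m l x)%:E = (x * ig_pdf m l x)%:E)%E.
    rewrite /= -EFinM; congr EFin; rewrite /ig_pdf; case: ifPn => [x0|_].
      by rewrite gtr0_norm.
    by rewrite !mulr0.
  over.
by rewrite integral_mul_ig_pdf// ltry.
Qed.

Lemma integral_ig_prob_id : (\int[ig_prob m l]_x x%:E = m%:E)%E.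
Proof.
rewrite integral_ig_prob//; last exact: integrable_ig_prob_id.
exact: integral_mul_ig_pdf.
Qed.

End ig_expectation.

(** * Divergence, signed log-likelihood and the final bound *)

(* In multiplicative form, the likelihood ratio also makes sense where both
   densities vanish. *)
Lemma ig_pdf_ratio (R : realType) (m l x y : R) : 0 < m -> 0 < x ->
  ig_pdf x l y =
  expR (l / 2 * (m ^- 2 - x ^- 2) * y + l * (x^-1 - m^-1)) * ig_pdf m l y.
Proof.
move=> m0 x0; rewrite /ig_pdf; case: ifPn => [y0|_]; last by rewrite mulr0.
rewrite [RHS]mulrCA -expRD; congr (_ * expR _).
by field; rewrite !gt_eqF.
Qed.

Lemma info_divergence_ig (R : realType) (m l x : R) :
  0 < m -> 0 < l -> 0 < x ->
  info_divergence (ig_prob x l) (ig_prob m l) =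
  (l * (x - m) ^+ 2 / (2 * m ^+ 2 * x))%:E.
Proof.
move=> m0 l0 x0.
pose a := l / 2 * (m ^- 2 - x ^- 2); pose b := l * (x^-1 - m^-1).
have mab : measurable_fun [set: R] (fun y => a * y + b).
  by apply: measurable_funD => //; exact: measurable_funM.
have mg : measurable_fun [set: R] (fun y => expR (a * y + b)).
  exact: measurableT_comp.
rewrite (info_divergence_density mg); first last.
- move=> A mA.
  (* Extending by zero outside [A] gives an integral over the whole line, which converts to Lebesgue
     measure. *)
  rewrite [RHS]integral_mkcond ge0_integral_ig_prob//; last 2 first.
  + apply/(measurable_restrictT _ _).1 => //.
    by apply: measurable_funTS; exact/measurable_EFinP.
  + by move=> y; rewrite patchE; case: ifP => // _; rewrite lee_fin expR_ge0.
  rewrite /= /ig_prob x0 l0/= [LHS]integral_mkcond; apply: eq_integral => y _.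
  rewrite !patchE; case: ifP => _; last by rewrite mul0e.
  by rewrite (ig_pdf_ratio l y m0 x0) EFinM.
- by move=> y; exact: expR_gt0.
have iid := integrable_ig_prob_id x0 l0.
(* The log-ratio is affine, so its integral is [a * x + b], [x] being the mean of [ig_prob x l]. *)
under eq_integral do rewrite expRK EFinD EFinM.
rewrite integralD//; last 2 first.
- exact: integrableZl.
- exact: finite_measure_integrable_cst.
rewrite integralZl// integral_ig_prob_id// integral_cst//.
have igT : ig_prob x l [set: R] = 1%E by exact: probability_setT.
rewrite [X in (_ + _ * X)%E]igT mule1.
rewrite -EFinM -EFinD; congr EFin; rewrite /a /b.
by field; rewrite !gt_eqF.
Qed.

Lemma ig_signed_loglikE (R : realType) (m l x : R) :
  0 < m -> 0 < l -> 0 < x ->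
  ig_signed_loglik m l x = (ig_arg m l (-1) x)%:E.
Proof.
move=> m0 l0 x0; rewrite /ig_signed_loglik leNgt x0/= info_divergence_ig//.
have -> : (2%:E * (l * (x - m) ^+ 2 / (2 * m ^+ 2 * x))%:E =
    (ig_arg m l (-1) x ^+ 2)%:E)%E.
  by rewrite -EFinM sqr_ig_argN1//; congr EFin; field; rewrite !gt_eqF.
(* The root of u^2 is |u|; since u is nonnegative exactly when [m <= x], the prescribed sign
   restores u. *)
rewrite /= sqrtr_sqr; case: ltP => [xm|mx].
  by rewrite ltr0_norm ?opprK// ltNge ig_argN1_ge0// -ltNge.
by rewrite ger0_norm// ig_argN1_ge0.
Qed.

Theorem theorem10 (R : realType) (d : measure_display) (T : measurableType d)
    (P : probability T R) (W : {RV P >-> R}) (m l : R)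
    (m_gt0 : 0 < m) (l_gt0 : 0 < l)
    (W_ig : forall A : set R, measurable A ->
      distribution P W A = ig_prob m l A)
    (x : R) (x_ge0 : 0 <= x) :
  (std_normal_cdf (ig_signed_loglik m l x) <= P [set w | (W w <= x)%R])%E.
Proof.
have [x_gt0|x_le0] := ltP 0 x; last first.
  (* Only [x = 0] remains: the signed log-likelihood is [-oo], and no real lies below it. *)
  rewrite /ig_signed_loglik x_le0 /std_normal_cdf.
  rewrite (_ : [set _ | _] = set0) ?measure0 ?measure_ge0//.
  by apply/seteqP; split.
rewrite ig_signed_loglikE// std_normal_cdfE.
apply: le_trans (ig_cdf_ge m_gt0 l_gt0 x_gt0) _.
by rewrite -W_ig// /distribution /pushforward.
Qed.
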